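(* Let $\lambda\in\mathbb{R}$, and let $\epsilon_1,\epsilon_2$ be admissible privacy levels for $\lambda$ (i.e. $\epsilon_i>0$, and additionally $\epsilon_i<-[\lambda(\lambda+1)]^{-1}$ if $\lambda(\lambda+1)<0$). (1) (Adaptive composition) Let $M_1(w,D)$ satisfy $(\lambda,\epsilon_1)$-PDP and let $M_2(W,D)|W$ satisfy $(\lambda,\epsilon_2)$-PDP (that is, for each given input $W=v$ the mechanism $D\mapsto M_2(v,D)$ satisfies $(\lambda,\epsilon_2)$-PDP). Then the composition $M^{(2)}(w,D)=(M_1(w,D),M_2(M_1(w,D),D))$ satisfies $(\lambda,\epsilon_1+\epsilon_2+\lambda(\lambda+1)\epsilon_1\epsilon_2)$-PDP. (2) (Sequential composition) Let $M_1(w,D)$ satisfy $(\lambda,\epsilon_1)$-PDP and $M_2(w,D)$ satisfy $(\lambda,\epsilon_2)$-PDP. Then the composition $M^{(2)}(w,D)=(M_1(w,D),M_2(w,D))$ satisfies $(\lambda,\epsilon_1+\epsilon_2+\lambda(\lambda+1)\epsilon_1\epsilon_2)$-PDP. (3) (Parallel composition) Let $M_1$ and $M_2$ satisfy $(\lambda,\epsilon_1)$-PDP and $(\lambda,\epsilon_2)$-PDP on two disjoint datasets $D_1$ and $D_2$ with distinct queries $w_1$ and $w_2$ respectively. Then the parallel composition $(M_1(w_1,D_1),M_2(w_2,D_2))$ satisfies $(\lambda,\max\{\epsilon_1,\epsilon_2\})$-PDP.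
   Context: Datasets are elements $D=(x_1,\dots,x_n)$ of a database $\mathcal{D}\subset\mathbb{R}^n$. The Hamming distance $\|D-D'\|_H$ is the number of indices $i$ with $x_i\ne x_i'$; $D,D'$ are adjacent if $\|D-D'\|_H=1$. A query is a measurable map $W:\mathcal{D}\to\mathbb{R}^m$, $w=W(D)$. A mechanism $M$ is a randomized algorithm: for each dataset $D$ (and input $w$, which is either the query evaluated at that dataset or a given fixed vector) $M(w,D)$ is a random vector in $\mathbb{R}^m$ with a density with respect to Lebesgue measure. Distinct mechanisms use independent randomness; in adaptive composition the conditional law of the second component given $M_1(w,D)=v$ is the law of $M_2(v,D)$. Power divergence: for distributions $P_1,P_2$ on $\mathbb{R}^m$ with densities $p_1,p_2$ and $\lambda\ne-1,0$, $D_\lambda(P_1,P_2)=\frac{1}{\lambda(\lambda+1)}\mathbf{E}_{X\sim p_2}\left[\left(\frac{p_1(X)}{p_2(X)}\right)^{\lambda+1}-1\right]$; $D_0,D_{-1}$ are defined by limits, and $D_0(P_1,P_2)=D_{-1}(P_2,P_1)=KL(P_1,P_2)$ (Kullback–Leibler divergence). For random vectors, $D_\lambda(X,Y)$ denotes the divergence of their laws. $(\lambda,\epsilon)$-PDP: let $\lambda\in\mathbb{R}$, $\epsilon>0$ if $\lambda(\lambda+1)\ge0$ and $0<\epsilon<-[\lambda(\lambda+1)]^{-1}$ otherwise. $M$ satisfies $(\lambda,\epsilon)$-PDP if $D_\lambda(M(w,D),M(w,D'))\le\epsilon$ for all adjacent $D,D'$. For parallel composition the data are pairs $(D_1,D_2)$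 with $D_i\in\mathcal{D}_i$, $D_1\cap D_2=\emptyset$, and $(D_1,D_2)$, $(D_1',D_2')$ are adjacent if $\|D_1-D_1'\|_H+\|D_2-D_2'\|_H=1$. *)

(* Defs.v *)
From HB Require Import structures.
From mathcomp Require Import all_boot all_order all_algebra.
From mathcomp Require Import all_classical all_reals all_analysis measurable_realfun.

Set Implicit Arguments.
Unset Strict Implicit.
Unset Printing Implicit Defensive.

Import Order.TTheory GRing.Theory Num.Theory.

Local Open Scope classical_set_scope.
Local Open Scope ring_scope.

(* Vectors of R^n are n.-tuple R, with the product sigma-algebra. *)

Section lebesgue_cons.
Context (R : realType) (n : nat).
Variable nu : {sigma_finite_measure set (n.-tuple R) -> \bar R}.
Local Open Scope ereal_scope.

Let cons_tuple (x : measurableTypeR R * n.-tuple R) : n.+1.-tuple R :=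
  [tuple of x.1 :: x.2].

Let measurable_cons_tuple : measurable_fun [set: _] cons_tuple.
Proof. exact: (measurable_cons measurable_fst measurable_snd). Qed.

Definition lebesgue_cons (A : set (n.+1.-tuple R)) : \bar R :=
  (@lebesgue_measure R \x nu) (cons_tuple @^-1` A).

Let measurable_pre A : measurable A -> measurable (cons_tuple @^-1` A).
Proof. by move=> mA; rewrite -[X in measurable X]setTI; exact: measurable_cons_tuple. Qed.

Let lebesgue_cons0 : lebesgue_cons set0 = 0.
Proof. by rewrite /lebesgue_cons preimage_set0 measure0. Qed.

Let lebesgue_cons_ge0 A : 0 <= lebesgue_cons A.
Proof. exact: measure_ge0. Qed.

Let lebesgue_cons_sigma_additive : semi_sigma_additive lebesgue_cons.
Proof.
move=> F mF tF mUF; rewrite /lebesgue_cons preimage_bigcup.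
apply: measure_semi_sigma_additive.
- by move=> i; exact: measurable_pre.
- apply/trivIsetP => /= i j _ _ ij; rewrite -preimage_setI.
  by move/trivIsetP : tF => /(_ _ _ _ _ ij) ->//; rewrite preimage_set0.
- by rewrite -preimage_bigcup; exact: measurable_pre.
Qed.

HB.instance Definition _ := isMeasure.Build _ _ _ lebesgue_cons
  lebesgue_cons0 lebesgue_cons_ge0 lebesgue_cons_sigma_additive.

Let uncons_tuple (t : n.+1.-tuple R) : measurableTypeR R * n.-tuple R :=
  (thead t, [tuple of behead t]).

Let measurable_uncons_tuple : measurable_fun [set: _] uncons_tuple.
Proof.
apply/measurable_fun_pairP; split.
  exact: (measurable_tnth (ord0 : 'I_n.+1)).
exact: measurable_behead.
Qed.

Let lebesgue_cons_sigma_finite : sigma_finite [set: _] lebesgue_cons.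
Proof.
have /sigma_finiteP[F [UF ndF mF]] := sigma_finiteT (@lebesgue_measure R).
have /sigma_finiteP[G [UG ndG mG]] := sigma_finiteT nu.
exists (fun i => uncons_tuple @^-1` (F i `*` G i)).
  apply/seteqP; split => // t _.
  have : setT (thead t) by [].
  have : setT ([tuple of behead t] : n.-tuple R) by [].
  rewrite {1}UF UG => -[j _ Gj] [i _ Fi]; exists (maxn i j) => //; split.
    by have /subsetPset := ndF _ _ (leq_maxl i j); exact.
  by have /subsetPset := ndG _ _ (leq_maxr i j); exact.
move=> i; have [mFi Fi] := mF i; have [mGi Gi] := mG i; split.
  rewrite -[X in measurable X]setTI; apply: measurable_uncons_tuple => //.
  exact: measurableX.
rewrite /lebesgue_cons -comp_preimage (_ : _ \o _ = id); last first.
  by apply/funext => -[x t]; congr pair; exact: val_inj.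
by rewrite preimage_id product_measure1E// lte_mul_pinfty// ge0_fin_numE.
Qed.

HB.instance Definition _ := Measure_isSigmaFinite.Build _ _ _ lebesgue_cons
  lebesgue_cons_sigma_finite.

End lebesgue_cons.

(* Lebesgue measure on R^n, as the n-fold product of lebesgue_measure. *)
Fixpoint lebesgue_tuple (R : realType) (n : nat) :
    {sigma_finite_measure set (n.-tuple R) -> \bar R} :=
  match n with
  | 0 => [the {sigma_finite_measure set (0.-tuple R) -> \bar R} of
           dirac ([tuple] : 0.-tuple R)]
  | m.+1 => [the {sigma_finite_measure set (m.+1.-tuple R) -> \bar R} of
           lebesgue_cons (lebesgue_tuple R m)]
  end.

Section power_divergence.
Context (R : realType) d (T : measurableType d).
Variable mu : {measure set T -> \bar R}.
Implicit Types P : probability T R.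
Local Open Scope ereal_scope.

Definition is_density P (p : T -> R) : Prop :=
  [/\ measurable_fun [set: T] p, (forall x, (0 <= p x)%R) &
      forall A, measurable A -> P A = \int[mu]_(x in A) (p x)%:E].

Definition has_density P : Prop := exists p, is_density P p.

(* A chosen version of the density; junk if there is none. *)
Definition density P : T -> R := xget (cst 0%R) [set p | is_density P p].

Definition KL P1 P2 : \bar R :=
  if `[< P1 `<< P2 >] then
    \int[P1]_x (ln (density P1 x / density P2 x))%:E
  else +oo.

(* a ^ r with 0 ^ r = +oo for r < 0; powR gives 0 there. *)
Definition pow_oo (a r : R) : \bar R :=
  if (a == 0%R) && (r < 0)%R then +oo else (a `^ r)%:E.

(* The expectation under P2 does not see the set where p2 = 0. There the usual
   convention p2 * f (p1 / p2) = p1 * lim_(t -> +oo) (f t / t) for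
   f t = (t ^ (lambda + 1) - 1) / (lambda * (lambda + 1)) contributes 0 if
   lambda < 0, and +oo if lambda > 0 and P1 charges that set; the latter is the
   third branch. *)
Definition power_divergence (lambda : R) P1 P2 : \bar R :=
  if lambda == 0%R then KL P1 P2
  else if lambda == (-1)%R then KL P2 P1
  else if (0 < lambda)%R && ~~ `[< P1 `<< P2 >] then +oo
  else ((lambda * (lambda + 1))^-1)%:E *
       \int[P2]_x (pow_oo (density P1 x / density P2 x) (lambda + 1) - 1).

End power_divergence.

Section privacy.
Context (R : realType).

Definition admissible (lambda eps : R) : Prop :=
  0 < eps /\ (lambda * (lambda + 1) < 0 -> eps < - (lambda * (lambda + 1))^-1).

Definition hamming n (D D' : n.-tuple R) : nat :=
  #|[set i : 'I_n | tnth D i != tnth D' i]|.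

(* PDP of a family of laws on (T, mu) indexed by the data in DB, where dist is
   the distance defining adjacency. *)
Definition PDP (X : Type) (DB : set X) (dist : X -> X -> nat)
    d (T : measurableType d) (mu : {measure set T -> \bar R})
    (lambda eps : R) (law : X -> probability T R) : Prop :=
  [/\ admissible lambda eps,
      forall D, DB D -> has_density mu (law D) &
      forall D D', DB D -> DB D' -> dist D D' = 1%N ->
        (power_divergence mu lambda (law D) (law D') <= eps%:E)%E].

(* M w D is the law of the output, in R^m, on input w in R^k and dataset D in
   R^n. *)
Definition mechanism (k n m : nat) : Type :=
  k.-tuple R -> n.-tuple R -> probability (m.-tuple R) R.

End privacy.

(* The law of (X, Y) where X has law P and, conditionally on X = v, Y has law
   K v. *)
Section adaptive_law.
Context (R : realType) d1 d2 (T1 : measurableType d1) (T2 : measurableType d2).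
Variables (P : probability T1 R) (K : T1 -> pprobability T2 R).
Local Open Scope ereal_scope.

Definition adaptive_law (mK : measurable_fun [set: T1] K)
    (A : set (T1 * T2)) : \bar R :=
  \int[P]_v K v (xsection A v).

Hypothesis mK : measurable_fun [set: T1] K.

Let adaptive_law0 : adaptive_law mK set0 = 0.
Proof. by rewrite /adaptive_law integral0_eq// => v _; rewrite xsection0 measure0. Qed.

Let adaptive_law_ge0 A : 0 <= adaptive_law mK A.
Proof. by apply: integral_ge0 => v _; exact: measure_ge0. Qed.

Let measurable_section A : measurable A ->
  measurable_fun [set: T1] ((fun v => K v (xsection A v)) : T1 -> \bar R).
Proof.
move=> mA.
exact: (measurable_fun_xsection_finite_kernel (kprobability mK) (mem_set mA)).
Qed.

Let adaptive_law_sigma_additive : semi_sigma_additive (adaptive_law mK).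
Proof.
move=> F mF tF mUF.
rewrite [X in _ --> X](_ : _ = \sum_(n <oo) adaptive_law mK (F n)).
  by apply/cvg_closeP; split; [exact: is_cvg_nneseries|rewrite closeE].
rewrite -integral_nneseries//; last by move=> n; exact: measurable_section.
apply: eq_integral => v _; apply/esym/cvg_lim => //=; rewrite xsection_bigcup.
apply: (measure_sigma_additive _ (trivIset_xsection tF)) => n.
exact: measurable_xsection.
Qed.

HB.instance Definition _ := isMeasure.Build _ _ _ (adaptive_law mK)
  adaptive_law0 adaptive_law_ge0 adaptive_law_sigma_additive.

Let adaptive_lawT : adaptive_law mK [set: T1 * T2] = 1.
Proof.
rewrite /adaptive_law -(@probability_setT _ _ _ P) -[RHS]mul1e.
rewrite -(integral_cst P measurableT); apply: eq_integral => v _ /=.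
by rewrite -setXTT in_xsectionX ?inE// probability_setT.
Qed.

HB.instance Definition _ := Measure_isProbability.Build _ _ _
  (adaptive_law mK) adaptive_lawT.

End adaptive_law.

Section composition.
Context (R : realType).

Definition adaptive_composition k n m1 m2 (M1 : mechanism R k n m1)
    (M2 : mechanism R m1 n m2)
    (mM2 : forall D, measurable_fun [set: m1.-tuple R]
                       (M2 ^~ D : _ -> pprobability (m2.-tuple R) R))
    (w : k.-tuple R) (D : n.-tuple R) :
    probability (m1.-tuple R * m2.-tuple R)%type R :=
  [the probability _ R of adaptive_law (M1 w D) (mM2 D)].

(* The law of a pair of independent vectors with laws P1 and P2. *)
Definition independent_law m1 m2 (P1 : probability (m1.-tuple R) R)
    (P2 : probability (m2.-tuple R) R) :
    probability (m1.-tuple R * m2.-tuple R)%type R :=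
  [the probability _ R of (P1 \x P2)%E].

Definition lebesgue_pair m1 m2 :
    {measure set (m1.-tuple R * m2.-tuple R)%type -> \bar R} :=
  [the {measure set _ -> \bar R} of
    (lebesgue_tuple R m1 \x lebesgue_tuple R m2)%E].

Definition parallel_database n1 n2 (DB1 : set (n1.-tuple R))
    (DB2 : set (n2.-tuple R)) : set (n1.-tuple R * n2.-tuple R) :=
  [set D | [/\ DB1 D.1, DB2 D.2 & forall i j, tnth D.1 i <> tnth D.2 j]].

Definition parallel_hamming n1 n2 (D D' : n1.-tuple R * n2.-tuple R) : nat :=
  (hamming D.1 D'.1 + hamming D.2 D'.2)%N.

End composition.

(* Main.v *)
Require Import Defs.
From HB Require Import structures.
From mathcomp Require Import all_boot all_order all_algebra.
From mathcomp Require Import all_classical all_reals all_analysis measurable_realfun.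
From mathcomp Require Import ring lra zify.

Set Implicit Arguments.
Unset Strict Implicit.
Unset Printing Implicit Defensive.

Import Order.TTheory GRing.Theory Num.Theory.

Local Open Scope classical_set_scope.
Local Open Scope ring_scope.

(** With [c = lambda * (lambda + 1)], outside of [lambda = 0, -1] the divergence
    is [(H - 1) / c], where [H] is the integral of
    [p1 `^ (lambda + 1) * p2 `^ (- lambda)]. This integrand is multiplicative,
    so if almost every section of a joint density is [p v * k v y] then [H] of
    the joint laws is an average of the [H] of the kernels against the integrand
    of the first components; hence [1 + c * e] is multiplicative under
    composition. For [lambda = 0, -1] the same computation is the chain rule of
    the Kullback-Leibler divergence.

    The joint laws have densities by Radon-Nikodym. To identify their sections,
    for each measurable [B] the masses of [B] under the section and under
    [p v * K v] agree for almost every [v]; as countably many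
    sets [B] suffice to determine a finite measure on [R^m], the null set can be
    chosen independently of [B]. *)

(** * Countably determined measures *)

Section countably_determined.
Context (R : realType).
Local Open Scope ereal_scope.

(** Stated through uniqueness of measures instead of generation of the sigma-algebra: in this form
    the property passes to products and along measurable bijections. *)
Definition countably_determined d (T : measurableType d) : Prop :=
  exists2 F : (set T)^nat, (forall n, measurable (F n)) &
    forall m1 m2 : {measure set T -> \bar R}, m1 [set: T] < +oo ->
      (forall n, m1 (F n) = m2 (F n)) ->
      forall A, measurable A -> m1 A = m2 A.

(** The open rays with rational endpoint, together with the whole line, are a countable family
    closed under intersection that generates the Borel sets. *)
Lemma countably_determined_real : countably_determined R.
Proof.
have [F [Frat FE]] : exists F : nat -> set R,
    (forall q, exists n, F n = `]ratr q, +oo[%classic) /\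
    (forall n, F n = setT \/ exists q, F n = `]ratr q, +oo[%classic).
  (* Codes that decode to no rational get the default [setT], which keeps the family closed under
     intersection. *)
  exists (fun n => if unpickle n is Some q then `]ratr q, +oo[%classic else setT).
  split=> [q|n]; first by exists (pickle q); rewrite pickleK.
  by case: unpickle => [q|]; [right; exists q|left].
have mF n : measurable (F n) by case: (FE n) => [|[q]] ->.
exists F => // m1 m2 m1oo m12.
(* The rays from [-k] form the exhausting sequence for the uniqueness theorem. *)
have [h Fh] := choice (fun k : nat => Frat (- k%:R)%R).
have cover : \bigcup_k F (h k) = setT.
  apply/seteqP; split => // x _.
  exists (Num.truncn (- x)%R).+1 => //; rewrite Fh /= in_itv/= andbT.
  by rewrite rmorphN/= ratr_nat ltrNl truncnS_gt.
apply: (measure_unique (range F) (fun k => F (h k))) => //.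
- apply/seteqP; split; last first.
    apply: smallest_sub; first exact: sigma_algebra_measurable.
    by move=> _ [n _ <-]; exact: mF.
  rewrite [X in X `<=` _](_ : _ = <<s @RGenOInfty.G R >>); last first.
    exact: RGenOInfty.measurableE.
  apply: smallest_sub.
    exact: smallest_sigma_algebra.
  (* A ray with real endpoint is the union of the rational rays contained in it; the inclusion is
     written as an equality with an intersection. *)
  move=> _ [x ->]; suff -> : `]x, +oo[%classic =
      \bigcup_(n in [set n | `]x, +oo[%classic `&` F n = F n]) F n.
    have [s0 _ sU] := smallest_sigma_algebra setT (range F).
    rewrite bigcup_mkcond; apply: sU => n; case: ifPn => // _.
    by apply: sub_sigma_algebra; exists n.
  apply/seteqP; split=> [y /=|y [n /= <-] [//]].
  rewrite in_itv/= andbT => /rat_in_itvoo[q]; rewrite in_itv/= => /andP[xq qy].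
  have [n Fn] := Frat q; exists n => /=; rewrite Fn; last by rewrite /= in_itv/= qy.
  apply/setIidPr => z /=; rewrite !in_itv/= !andbT.
  exact: lt_trans.
- move=> _ _ [i _ <-] [j _ <-].
  have [->|[p ip]] := FE i; first by rewrite setTI; exists j.
  have [->|[q jq]] := FE j; first by rewrite setIT; exists i.
  have [n Fn] := Frat (Num.max p q); exists n => //; rewrite ip jq Fn.
  have -> : ratr (Num.max p q) = Num.max (ratr p) (ratr q) :> R.
    by rewrite !maxEle ler_rat; case: ifP.
  by apply/seteqP; split=> z /=; rewrite !in_itv/= !andbT gt_max => /andP.
- by move=> _ [n _ <-].
- by move=> k; apply: le_lt_trans m1oo; apply: le_measure; rewrite ?inE.
Qed.

(** Bundles the pushforward as a measure, so that [countably_determined] applies to traces and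
    images of a measure. *)
Lemma measure_image d1 d2 (T1 : measurableType d1) (T2 : measurableType d2)
    (m : {measure set T1 -> \bar R}) (f : T1 -> T2) :
  measurable_fun [set: T1] f ->
  exists m' : {measure set T2 -> \bar R}, forall A, m' A = m (f @^-1` A).
Proof.
move=> mf; unshelve eexists (pushforward m f : {measure set T2 -> \bar R}) => //.
Qed.

(** Rectangles are reached in two passes: with the second side [G j] fixed, [detF] gives every
    measurable first side; with that side fixed, [detG] gives every second side. *)
Lemma countably_determined_prod d1 d2 (T1 : measurableType d1)
    (T2 : measurableType d2) :
  countably_determined T1 -> countably_determined T2 ->
  countably_determined (T1 * T2)%type.
Proof.
move=> [F mF detF] [G mG detG].
have [h hK] : exists h : nat -> nat * nat, forall i j, exists n, h n = (i, j).
  exists (fun n => odflt (0, 0)%N (unpickle n)) => i j.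
  by exists (pickle (i, j)); rewrite pickleK.
exists (fun n => F (h n).1 `*` G (h n).2) => [n|]; first exact: measurableX.
move=> m1 m2 m1oo m12.
have FG i j : m1 (F i `*` G j) = m2 (F i `*` G j).
  by have [n hn] := hK i j; have := m12 n; rewrite hn.
(* Restricting to [D] and pushing forward along a projection turns the masses of rectangles with one
   fixed side into a measure on the other factor. *)
have trace (m : {measure set (T1 * T2) -> \bar R}) d (T : measurableType d)
    (f : T1 * T2 -> T) D : measurable D -> measurable_fun setT f ->
    exists m' : {measure set T -> \bar R}, forall A, m' A = m (f @^-1` A `&` D).
  by move=> mD mf; have [m' m'E] := measure_image (mrestr m mD) mf; exists m'.
have AG A j : measurable A -> m1 (A `*` G j) = m2 (A `*` G j).
  move=> mA; have mTG := measurableX (@measurableT _ T1) (mG j).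
  have [m1' m1E] := trace m1 _ _ _ _ mTG measurable_fst.
  have [m2' m2E] := trace m2 _ _ _ _ mTG measurable_fst.
  have sE B : fst @^-1` B `&` [set: T1] `*` G j = B `*` G j.
    by apply/seteqP; split => [[x y] /= [? []]|[x y] /= []].
  rewrite -(sE A) -m1E -m2E; apply: detF => // [|n]; last by rewrite m1E m2E sE.
  by rewrite m1E; apply: le_lt_trans m1oo; apply: le_measure; rewrite ?inE ?sE.
have AB A B : measurable A -> measurable B -> m1 (A `*` B) = m2 (A `*` B).
  move=> mA mB; have mAT := measurableX mA (@measurableT _ T2).
  have [m1' m1E] := trace m1 _ _ _ _ mAT measurable_snd.
  have [m2' m2E] := trace m2 _ _ _ _ mAT measurable_snd.
  have sE C : snd @^-1` C `&` A `*` [set: T2] = A `*` C.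
    by apply/seteqP; split => [[x y] /= [? []]|[x y] /= []].
  rewrite -(sE B) -m1E -m2E; apply: detG => // [|n].
    by rewrite m1E; apply: le_lt_trans m1oo; apply: le_measure; rewrite ?inE ?sE.
  by rewrite m1E m2E sE AG.
(* Rectangles are closed under intersection and, [m1] being finite, the constant sequence [setT]
   exhausts the space. *)
move=> A mA; apply: (measure_unique
    [set X `*` Y | X in @measurable _ T1 & Y in @measurable _ T2] (fun=> setT)).
- exact: measurable_prod_measurableType.
- move=> _ _ [X1 mX1 [Y1 mY1 <-]] [X2 mX2 [Y2 mY2 <-]].
  exists (X1 `&` X2); first exact: measurableI.
  by exists (Y1 `&` Y2); [exact: measurableI|rewrite setXI].
- by move=> _; exists setT => //; exists setT => //; rewrite setXTT.
- by rewrite bigcup_const//; exists 0%N.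
- by move=> _ [X mX [Y mY <-]]; exact: AB.
- by [].
- by [].
Qed.

(** Induction on [n]: a one-point space has only two subsets, and [cons] and [uncons] identify the
    tuples of length [n.+1] with a product. *)
Lemma countably_determined_tuple n :
  countably_determined (n.-tuple R).
Proof.
elim: n => [|n IH].
  exists (fun=> setT) => // m1 m2 _ m12 A mA.
  have [->|/set0P[x Ax]] := eqVneq A set0; first by rewrite !measure0.
  suff -> : A = setT by exact: m12 0%N.
  by apply/seteqP; split => // y _; rewrite (tuple0 y) -(tuple0 x).
have [F mF detF] := countably_determined_prod countably_determined_real IH.
pose cons (x : R * n.-tuple R) :
  n.+1.-tuple R := [tuple of x.1 :: x.2].
pose uncons (t : n.+1.-tuple R) :
  R * n.-tuple R := (thead t, [tuple of behead t]).
have mcons : measurable_fun setT cons.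
  exact: (measurable_cons measurable_fst measurable_snd).
have muncons : measurable_fun setT uncons.
  apply/measurable_fun_pairP; split; last exact: measurable_behead.
  exact: (measurable_tnth (ord0 : 'I_n.+1)).
have consK t : cons (uncons t) = t by rewrite [RHS]tuple_eta; exact: val_inj.
exists (fun n => uncons @^-1` F n) => [k|m1 m2 m1oo m12 A mA].
  by rewrite -[X in measurable X]setTI; exact: muncons.
have <- : uncons @^-1` (cons @^-1` A) = A.
  by apply/seteqP; split => t /=; rewrite consK.
have [m1' m1E] := measure_image m1 muncons.
have [m2' m2E] := measure_image m2 muncons.
rewrite -m1E -m2E; apply: detF => [|k|]; rewrite ?m1E ?m2E//.
by rewrite -[X in measurable X]setTI; exact: mcons.
Qed.

End countably_determined.

(** * Densities of joint laws *)

Section density.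
Context (R : realType) d (T : measurableType d).
Variable mu : {sigma_finite_measure set T -> \bar R}.
Implicit Types P : probability T R.
Local Open Scope ereal_scope.

(** The Radon-Nikodym derivative is nonnegative and finite everywhere, so [fine] makes it a real
    density. *)
Lemma has_density_dominated P : P `<< mu -> has_density mu P.
Proof.
move=> Pmu; pose f := Radon_Nikodym_SigmaFinite.f P mu.
have f0 := Radon_Nikodym_SigmaFinite.f_ge0 Pmu : forall x, 0 <= f x.
have ffin := Radon_Nikodym_SigmaFinite.f_fin_num Pmu : forall x, f x \is a fin_num.
have mf := measurable_int _ (Radon_Nikodym_SigmaFinite.f_integrable Pmu).
exists (fine \o f); split => [|x|A mA].
- by apply: measurableT_comp => //; exact: fine_measurable.
- by rewrite /= fine_ge0.
- rewrite (Radon_Nikodym_SigmaFinite.f_integral Pmu)//; apply: eq_integral => x _.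
  by rewrite /= fineK.
Qed.

Lemma densityP P : has_density mu P -> is_density mu P (density mu P).
Proof.
move=> [p pP]; apply: (@xgetPex _ (cst 0%R) [set p | is_density mu P p]).
by exists p.
Qed.

Section is_density.
Variables (P : probability T R) (p : T -> R).
Hypothesis Pp : is_density mu P p.

Lemma measurable_density : measurable_fun [set: T] p. Proof. by case: Pp. Qed.

Lemma density_ge0 x : (0 <= p x)%R. Proof. by case: Pp. Qed.

Lemma measurable_EFin_density : measurable_fun [set: T] (EFin \o p).
Proof. exact/measurable_EFinP/measurable_density. Qed.

Lemma integral_density : \int[mu]_x (p x)%:E = 1.
Proof. by case: Pp => _ _ <- //; rewrite probability_setT. Qed.

Lemma is_density_dominated : P `<< mu.
Proof.
apply/null_content_dominatesP => A mA muA0; case: Pp => mp p0 ->//.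
by apply: null_set_integral => //; apply: measurable_funTS;
  exact: measurable_EFin_density.
Qed.

(** Change of variables holds for the Radon-Nikodym derivative, and [p] agrees with it almost
    everywhere, having the same integral over every measurable set. *)
Lemma integral_is_density (f : T -> \bar R) : measurable_fun [set: T] f ->
  (forall x, 0 <= f x) -> \int[P]_x f x = \int[mu]_x (f x * (p x)%:E).
Proof.
move=> mf f0; have Pmu := is_density_dominated.
rewrite -(Radon_Nikodym_SigmaFinite.change_of_variables Pmu)//.
have rn0 := Radon_Nikodym_SigmaFinite.f_ge0 Pmu.
have rni := Radon_Nikodym_SigmaFinite.f_integrable Pmu.
apply: ge0_ae_eq_integral => //.
- by apply: emeasurable_funM => //; exact: measurable_int rni.
- exact/emeasurable_funM/measurable_EFin_density.
- by move=> x _; rewrite mule_ge0.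
- by move=> x _; rewrite mule_ge0// lee_fin density_ge0.
apply: ae_eqe_mul2l; apply: integral_ae_eq => //.
  exact: measurable_EFin_density.
move=> A _ mA; rewrite -Radon_Nikodym_SigmaFinite.f_integral//.
by have [_ _ PA] := Pp; exact: PA.
Qed.

End is_density.

End density.

(** Serves to view the mass under a section of a joint density as a measure. *)
Lemma measure_with_density (R : realType) d (T : measurableType d)
    (mu : {measure set T -> \bar R}) (f : T -> \bar R) :
  measurable_fun [set: T] f -> (forall x, 0 <= f x)%E ->
  exists m : {measure set T -> \bar R},
    forall A, m A = (\int[mu]_(x in A) f x)%E.
Proof.
move=> mf f0; pose nu A : \bar R := (\int[mu]_(x in A) f x)%E.
have nu0 : nu set0 = 0%E by rewrite /nu integral_set0.
have nu_ge0 A : (0 <= nu A)%E by exact: integral_ge0.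
have nuD : semi_sigma_additive nu by exact: semi_sigma_additive_nng_induced.
pose m : {measure set T -> \bar R} :=
  HB.pack nu (isMeasure.Build _ _ _ nu nu0 nu_ge0 nuD).
by exists m.
Qed.

Section product_sigma_finite.
Context (R : realType) d1 d2 (T1 : measurableType d1) (T2 : measurableType d2).
Variables (mu1 : {sigma_finite_measure set T1 -> \bar R})
          (mu2 : {sigma_finite_measure set T2 -> \bar R}).
Local Open Scope ereal_scope.

(** Both exhaustions are increasing, so the diagonal products of [F n] and [G n] already cover the
    space. *)
Lemma sigma_finite_product : sigma_finite [set: T1 * T2] (mu1 \x mu2).
Proof.
have /sigma_finiteP[F [UF ndF mF]] := sigma_finiteT mu1.
have /sigma_finiteP[G [UG ndG mG]] := sigma_finiteT mu2.
exists (fun n => F n `*` G n) => [|n].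
  rewrite -setXTT UF UG; apply/seteqP; split => [[x y]|[x y] [n _ [? ?]]].
    move=> [[i _ Fi] [j _ Gj]]; exists (maxn i j) => //; split.
      by have /subsetPset := ndF _ _ (leq_maxl i j); exact.
    by have /subsetPset := ndG _ _ (leq_maxr i j); exact.
  by split; exists n.
have [mFn Fn] := mF n; have [mGn Gn] := mG n.
split; first exact: measurableX.
by rewrite product_measure1E// lte_mul_pinfty// ge0_fin_numE.
Qed.

(* The instance that the library declares for [\x] is only found for
   subprobabilities. *)
Definition sigma_finite_prod :
    {sigma_finite_measure set (T1 * T2)%type -> \bar R} :=
  HB.pack (mu1 \x mu2)
    (Measure_isSigmaFinite.Build _ _ _ (mu1 \x mu2) sigma_finite_product).

End product_sigma_finite.

(** * Joint laws given by a first marginal and a kernel *)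

Section joint_density.
Context (R : realType) d1 d2 (T1 : measurableType d1) (T2 : measurableType d2).
Variables (mu1 : {sigma_finite_measure set T1 -> \bar R})
          (mu2 : {sigma_finite_measure set T2 -> \bar R}).
Hypothesis detT2 : countably_determined R T2.
Variables (P : probability T1 R) (K : T1 -> pprobability T2 R).
Variable Q : probability (T1 * T2)%type R.
Hypothesis mK : measurable_fun [set: T1] K.
Local Open Scope ereal_scope.
Hypothesis QE : forall A, measurable A -> Q A = \int[P]_v K v (xsection A v).

Let measurable_K B : measurable B -> measurable_fun [set: T1] (fun v => K v B).
Proof. exact: (measurable_kernel (kprobability mK)). Qed.

(** Almost every section of a null set of the product is [mu2]-null, hence null for [K v]; as [mu1]
    dominates [P], integrating over [v] gives 0. *)
Lemma has_density_joint : has_density mu1 P ->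
  (forall v, has_density mu2 (K v)) -> has_density (mu1 \x mu2) Q.
Proof.
move=> /densityP Pp Kk.
apply: (@has_density_dominated R _ _ (sigma_finite_prod mu1 mu2)).
apply/null_content_dominatesP => A mA.
rewrite /= /product_measure1 => mA0; rewrite QE//.
rewrite (ae_eq_integral (cst 0))// ?integral0//.
  exact: (measurable_fun_xsection_finite_kernel (kprobability mK) (mem_set mA)).
apply: (null_dominates_ae_eq measurableT (is_density_dominated Pp)).
have : ae_eq mu1 setT (mu2 \o xsection A) (cst 0).
  apply/ae_eq_integral_abs => //.
    exact: measurable_fun_xsection.
  by under eq_integral do rewrite gee0_abs//.
apply: filterS => v /= /(_ Logic.I) muA0 _.
have /null_content_dominatesP Kmu := is_density_dominated (densityP (Kk v)).
by apply: Kmu => //; exact: measurable_xsection.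
Qed.

Section sections.
Variables (p : T1 -> R) (k : T1 -> T2 -> R) (q : T1 * T2 -> R).
Hypothesis Pp : is_density mu1 P p.
Hypothesis Kk : forall v, is_density mu2 (K v) (k v).
Hypothesis Qq : is_density (mu1 \x mu2) Q q.

Let mq : measurable_fun [set: T1 * T2] (EFin \o q).
Proof. exact: (@measurable_EFin_density _ _ _ (sigma_finite_prod mu1 mu2) Q). Qed.

Let mqv v : measurable_fun [set: T2] (fun y => (q (v, y))%:E).
Proof. exact: (measurableT_comp mq (pair1_measurable v)). Qed.

Let q0 x : (0 <= q x)%R. Proof. by case: Qq. Qed.

Let mass_section B v := \int[mu2]_(y in B) (q (v, y))%:E.

Let mass_section_ge0 B v : 0 <= mass_section B v.
Proof. by apply: integral_ge0 => y _; rewrite lee_fin. Qed.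

Let measurable_mass_section B : measurable B ->
  measurable_fun [set: T1] (mass_section B).
Proof.
move=> mB; rewrite /mass_section.
under eq_fun do rewrite integral_mkcond.
apply: (@measurable_fun_fubini_tonelli_F _ _ _ _ _ mu2
  (fun z => ((fun y => (q (z.1, y))%:E) \_ B) z.2)) => [|z]; last first.
  by rewrite patchE; case: ifP => // _; rewrite lee_fin.
rewrite [X in measurable_fun _ X](_ : _ = (EFin \o q) \_ (setT `*` B)).
  apply/(measurable_restrictT _ _).1 => //; first exact: measurableX.
  exact: measurable_funTS.
apply/funext => -[x y]; rewrite !patchE /=; congr (if _ then _ else _).
by rewrite in_setX /= in_setT.
Qed.

Lemma joint_mass_rectangle A B : measurable A -> measurable B ->
  Q (A `*` B) = \int[mu1]_(v in A) mass_section B v.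
Proof.
move=> mA mB; case: Qq => _ _ ->; last exact: measurableX.
rewrite integral_mkcond.
rewrite fubini_tonelli1; last 2 first.
  apply/(measurable_restrictT _ _).1 => //; first exact: measurableX.
  exact: measurable_funTS.
  by move=> z; rewrite patchE; case: ifP => // _; rewrite lee_fin.
rewrite [RHS]integral_mkcond; apply: eq_integral => v _.
rewrite patchE /fubini_F; case: ifPn => vA.
  rewrite /mass_section [RHS]integral_mkcond; apply: eq_integral => y _.
  by rewrite !patchE in_setX vA.
by apply: integral0_eq => y _; rewrite patchE in_setX (negbTE vA).
Qed.

(** Over every measurable [A] both sides integrate to the mass under [Q] of the rectangle with sides
    [A] and [B]. The exceptional set depends on [B]. *)
Lemma ae_mass_section B : measurable B ->
  {ae mu1, forall v, mass_section B v = (p v)%:E * K v B}.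
Proof.
move=> mB; suff : ae_eq mu1 setT (mass_section B) (fun v => (p v)%:E * K v B).
  by apply: filterS => v /(_ Logic.I).
apply: integral_ae_eq => //.
- apply/integrableP; split; first exact: measurable_mass_section.
  under eq_integral do rewrite gee0_abs ?mass_section_ge0//.
  rewrite -joint_mass_rectangle//.
  by rewrite (le_lt_trans (probability_le1 _ _)) ?ltry//; exact: measurableX.
- apply: emeasurable_funM; last exact: measurable_K.
  exact: measurable_EFin_density Pp.
move=> A _ mA; rewrite -joint_mass_rectangle// QE; last exact: measurableX.
rewrite (integral_is_density Pp)//; last 1 first.
  apply: (measurable_fun_xsection_finite_kernel (kprobability mK)).
  by rewrite inE; exact: measurableX.
rewrite [RHS]integral_mkcond; apply: eq_integral => v _.
rewrite patchE; case: ifPn => vA; first by rewrite in_xsectionX// muleC.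
by rewrite notin_xsectionX// measure0 mul0e.
Qed.

Lemma ae_joint_density :
  {ae mu1, forall v, ae_eq mu2 setT (fun y => (q (v, y))%:E)
                                    (fun y => (p v * k v y)%:E)}.
Proof.
have [F mF detF] := detT2.
have : {ae mu1, forall v n, mass_section (F n) v = (p v)%:E * K v (F n)}.
  by apply: ae_foralln => n; exact: ae_mass_section.
(* The whole space supplies the finite total mass under which [F] determines a measure. *)
have : {ae mu1, forall v, mass_section setT v = (p v)%:E * K v setT}.
  exact: ae_mass_section.
apply: filterS2 => v vT vF.
have p0 := density_ge0 Pp v.
have [m mE] : exists m : {measure set T2 -> \bar R}, forall B, m B = mass_section B v.
  by apply: measure_with_density => // y; rewrite lee_fin.
have vB B : measurable B -> mass_section B v = (p v)%:E * K v B.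
  move=> mB; rewrite -mE.
  (* The section mass is compared with the measure [K v] scaled by [p v]. *)
  rewrite (detF m (mscale (NngNum p0) (K v)))// ?mE ?vT//.
    by rewrite probability_setT mule1 ltry.
  by move=> n; rewrite mE vF.
apply: integral_ae_eq => //.
- apply/integrableP; split; first exact: mqv.
  under eq_integral do rewrite /= ger0_norm//.
  by rewrite -/(mass_section setT v) vT probability_setT mule1 ltry.
- apply/measurable_EFinP/measurable_funM => //.
  exact: measurable_density (Kk v).
move=> B _ mB; rewrite -/(mass_section B v) vB//.
case: (Kk v) => mk k0 ->//; rewrite -ge0_integralZl//.
- by apply/measurable_funTS/measurable_EFinP.
- by move=> y _; rewrite lee_fin.
Qed.

End sections.

End joint_density.

(** * Integrands of the divergences *)

Section integrands.
Context (R : realType).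
Implicit Types (r a b : R).
Local Open Scope ereal_scope.

Lemma pow_oo_ge0 a r : 0 <= pow_oo a r.
Proof. by rewrite /pow_oo; case: ifP => // _; rewrite lee_fin powR_ge0. Qed.

Lemma pow_ooE a r : (0 < a)%R -> pow_oo a r = (a `^ r)%:E.
Proof. by move=> a0; rewrite /pow_oo gt_eqF. Qed.

Lemma pow_oo0 r : (0 < r)%R -> pow_oo 0 r = 0 :> \bar R.
Proof. by move=> r0; rewrite /pow_oo eqxx/= ltNge (ltW r0)/= powR0 ?gt_eqF. Qed.

Lemma pow_oo0_lt0 r : (r < 0)%R -> pow_oo 0 r = +oo :> \bar R.
Proof. by move=> r0; rewrite /pow_oo eqxx r0. Qed.

Lemma pow_oo_gt0 a r : (r < 0)%R -> (0 <= a)%R -> 0 < pow_oo a r.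
Proof.
move=> r0; rewrite le_eqVlt => /predU1P[<-|a0]; first by rewrite pow_oo0_lt0.
by rewrite pow_ooE// lte_fin powR_gt0.
Qed.

(** For [r < 0] all values are positive, so a zero factor makes both sides +oo and the product of 0
    and +oo never occurs. *)
Lemma pow_ooM a b r : (0 <= a)%R -> (0 <= b)%R ->
  pow_oo (a * b) r = pow_oo a r * pow_oo b r.
Proof.
move=> a0 b0; have [r0|r0] := ltP r 0%R; last first.
  by rewrite /pow_oo !ltNge r0 !andbF -EFinM powRM.
move: a0 b0; rewrite le_eqVlt => /predU1P[<- b0|a0].
  by rewrite mul0r pow_oo0_lt0// gt0_mulye// pow_oo_gt0.
rewrite le_eqVlt => /predU1P[<-|b0].
  by rewrite mulr0 pow_oo0_lt0// gt0_muley// pow_oo_gt0// ltW.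
by rewrite !pow_ooE ?mulr_gt0// -EFinM powRM// ltW.
Qed.

Lemma measurable_pow_oo r : measurable_fun [set: R] (@pow_oo R ^~ r).
Proof.
rewrite /pow_oo; apply: measurable_fun_ifT => //.
  by apply: measurable_and => //; exact: measurable_fun_eqr.
by apply/measurable_EFinP; exact: measurable_powR.
Qed.

(* The integrand [a `^ (r + 1) * b `^ (- r)] of the power divergence; since
   [0 * +oo = 0], this product has the right value wherever [a] or [b] is 0. *)
Definition power_integrand r a b : \bar R := pow_oo a (r + 1) * pow_oo b (- r).

Lemma power_integrand_ge0 r a b : 0 <= power_integrand r a b.
Proof. by rewrite mule_ge0// pow_oo_ge0. Qed.

Lemma power_integrandM r a b a' b' :
  (0 <= a)%R -> (0 <= b)%R -> (0 <= a')%R -> (0 <= b')%R ->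
  power_integrand r (a * a') (b * b') =
  power_integrand r a b * power_integrand r a' b'.
Proof.
move=> a0 b0 a'0 b'0; rewrite /power_integrand (pow_ooM _ a0 a'0).
by rewrite (pow_ooM _ b0 b'0) muleACA.
Qed.

(** At [a = 0] one of the exponents [r + 1] and [- r] is positive, and its factor is 0. *)
Lemma power_integrand_diag r a : r != 0%R -> r != (-1)%R -> (0 <= a)%R ->
  power_integrand r a a = a%:E.
Proof.
move=> r0 r1; rewrite le_eqVlt => /predU1P[<-|a0]; last first.
  rewrite /power_integrand !pow_ooE// -EFinM -powRD ?(gt_eqF a0) ?implybT//.
  by rewrite addrAC subrr add0r powRr1// ltW.
have [r_lt0|r_gt0|/eqP] := ltgtP r 0%R; last by rewrite (negbTE r0).
  by rewrite /power_integrand; rewrite (@pow_oo0 (- r)) ?mule0// oppr_gt0.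
by rewrite /power_integrand (@pow_oo0 (r + 1)) ?mul0e// addr_gt0.
Qed.

(** The weight [b] of the second density turns the exponent [- (r + 1)] of [b] into [- r]. *)
Lemma power_integrand_div r a b : (0 <= a)%R -> (0 < b)%R ->
  pow_oo (a / b) (r + 1) * b%:E = power_integrand r a b.
Proof.
move=> a0 b0; rewrite /power_integrand pow_ooM ?invr_ge0 ?(ltW b0)// -muleA.
congr (_ * _); rewrite !pow_ooE ?invr_gt0// -EFinM; congr EFin.
rewrite -(powR_inv1 (ltW b0)) -powRrM mulN1r opprD.
rewrite powRD ?(gt_eqF b0) ?implybT//.
by rewrite powR_inv1 ?ltW// divfK// gt_eqF.
Qed.

Lemma measurable_power_integrand d (T : measurableType d) r (f g : T -> R) :
  measurable_fun [set: T] f -> measurable_fun [set: T] g ->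
  measurable_fun [set: T] (fun x => power_integrand r (f x) (g x)).
Proof.
by move=> mf mg; apply: emeasurable_funM;
  apply: (measurableT_comp (measurable_pow_oo _)).
Qed.

(* The integrand of the Kullback-Leibler divergence, made nonnegative by the
   term [b - a], whose integral vanishes for probability densities. *)
Definition KL_integrand a b : \bar R :=
  if (b == 0%R) && (a != 0%R) then +oo else (a * ln (a / b) + b - a)%:E.

Lemma KL_integrand0l b : KL_integrand 0 b = b%:E.
Proof. by rewrite /KL_integrand eqxx andbF mul0r add0r subr0. Qed.

Lemma KL_integrand0r a : (0 < a)%R -> KL_integrand a 0 = +oo.
Proof. by move=> a0; rewrite /KL_integrand eqxx gt_eqF. Qed.

Lemma KL_integrandE a b : (0 < b)%R ->
  KL_integrand a b = (a * ln (a / b) + b - a)%:E.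
Proof. by move=> b0; rewrite /KL_integrand gt_eqF. Qed.

(** This is [ln (1 + x) <= x] at [x = b / a - 1], multiplied by [a]. *)
Lemma mulr_ln_ge a b : (0 < a)%R -> (0 < b)%R -> (a - b <= a * ln (a / b))%R.
Proof.
move=> a0 b0.
have := @le_ln1Dx R (b / a - 1); rewrite ltrBrDr addNr divr_gt0// => /(_ isT).
rewrite addrC subrK -(ler_pM2l a0) mulrBr mulr1 mulrCA divff ?gt_eqF// mulr1.
rewrite !ln_div ?posrE// => H; rewrite -lerN2 opprB (le_trans _ H)//.
by rewrite -mulrN opprB.
Qed.

Lemma KL_integrand_ge0 a b : (0 <= a)%R -> (0 <= b)%R -> 0 <= KL_integrand a b.
Proof.
rewrite le_eqVlt => /predU1P[<-|a0]; first by rewrite KL_integrand0l lee_fin.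
rewrite le_eqVlt => /predU1P[<-|b0]; first by rewrite KL_integrand0r.
by rewrite KL_integrandE// lee_fin -addrA -opprB subr_ge0 mulr_ln_ge.
Qed.

Lemma KL_integrand_diag a : (0 <= a)%R -> KL_integrand a a = 0.
Proof.
rewrite le_eqVlt => /predU1P[<-|a0]; first by rewrite KL_integrand0l.
by rewrite KL_integrandE// divff ?gt_eqF// ln1 mulr0 add0r subrr.
Qed.

(** Pointwise chain rule, from the additivity of [ln]. The corrections [b - a] are distributed so
    that both sides are sums of nonnegative terms and infinite values cause no cancellation. *)
Lemma KL_integrandM a b a' b' :
  (0 <= a)%R -> (0 <= b)%R -> (0 <= a')%R -> (0 <= b')%R ->
  KL_integrand (a * a') (b * b') + (b * a' + a * b')%:E =
  KL_integrand a b * a'%:E + a%:E * KL_integrand a' b' + (a * a' + b * b')%:E.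
Proof.
move=> + + a'_ge0 b'_ge0.
rewrite le_eqVlt => /predU1P[<-|a0] b_ge0.
  rewrite !mul0r !KL_integrand0l mul0e adde0 -!EFinM -!EFinD; congr EFin.
  by rewrite addr0 add0r addrC.
move: a'_ge0; rewrite le_eqVlt => /predU1P[<-|a'0].
  rewrite !mulr0 !KL_integrand0l mule0 add0e -!EFinM -!EFinD; congr EFin.
  by rewrite !add0r addrC.
(* Here [a] and [a'] are positive, so a zero second argument makes both sides +oo. *)
move: b_ge0; rewrite le_eqVlt => /predU1P[<-|b0].
  rewrite !mul0r !KL_integrand0r ?mulr_gt0// gt0_mulye ?lte_fin//.
  rewrite -addeA !addye// -ltNye (lt_le_trans (ltNyr 0))//.
  by rewrite adde_ge0 ?mule_ge0 ?KL_integrand_ge0 ?lee_fin ?addr_ge0 ?mulr_ge0// ltW.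
move: b'_ge0; rewrite le_eqVlt => /predU1P[<-|b'0].
  rewrite !mulr0 !KL_integrand0r ?mulr_gt0// gt0_muley ?lte_fin//.
  by rewrite KL_integrandE// -EFinM addye// addey.
rewrite !KL_integrandE ?mulr_gt0// -!EFinM -!EFinD; congr EFin.
rewrite !ln_div ?posrE ?mulr_gt0// !lnM ?posrE//; ring.
Qed.

Lemma measurable_KL_integrand d (T : measurableType d) (f g : T -> R) :
  (forall x, 0 <= g x)%R ->
  measurable_fun [set: T] f -> measurable_fun [set: T] g ->
  measurable_fun [set: T] (fun x => KL_integrand (f x) (g x)).
Proof.
move=> g0 mf mg; apply: measurable_fun_ifT => //.
  apply: measurable_and; first exact: measurable_fun_eqr.
  by apply: measurable_neg; exact: measurable_fun_eqr.
apply/measurable_EFinP/measurable_funB => //; apply: measurable_funD => //.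
apply: measurable_funM => //; apply: measurableT_comp; first exact: measurable_ln.
apply: measurable_funM => //.
under eq_fun do rewrite -powR_inv1//.
exact: (measurableT_comp (measurable_powR _) mg).
Qed.

End integrands.

(** * Divergences as integrals against the reference measure *)

Section power_divergence_integral.
Context (R : realType) d (T : measurableType d).
Variable mu : {sigma_finite_measure set T -> \bar R}.
Implicit Types (P : probability T R) (r : R).
Local Open Scope ereal_scope.

Definition power_integral r (p1 p2 : T -> R) : \bar R :=
  \int[mu]_x power_integrand r (p1 x) (p2 x).

Definition KL_integral (p1 p2 : T -> R) : \bar R :=
  \int[mu]_x KL_integrand (p1 x) (p2 x).

Variables (P1 P2 : probability T R) (p1 p2 : T -> R).
Hypotheses (P1p : is_density mu P1 p1) (P2p : is_density mu P2 p2).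

Let p1_ge0 x : (0 <= p1 x)%R. Proof. exact: density_ge0 P1p x. Qed.
Let p2_ge0 x : (0 <= p2 x)%R. Proof. exact: density_ge0 P2p x. Qed.
Let mp1 : measurable_fun [set: T] p1. Proof. exact: measurable_density P1p. Qed.
Let mp2 : measurable_fun [set: T] p2. Proof. exact: measurable_density P2p. Qed.
Let mp1E : measurable_fun [set: T] (EFin \o p1).
Proof. exact: measurable_EFin_density P1p. Qed.
Let mp2E : measurable_fun [set: T] (EFin \o p2).
Proof. exact: measurable_EFin_density P2p. Qed.

Let mpow r : measurable_fun [set: T] (fun x => power_integrand r (p1 x) (p2 x)).
Proof. exact: measurable_power_integrand. Qed.

Let mKL : measurable_fun [set: T] (fun x => KL_integrand (p1 x) (p2 x)).
Proof. exact: measurable_KL_integrand. Qed.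

Let mratio : measurable_fun [set: T] (fun x => p1 x / p2 x)%R.
Proof.
apply: measurable_funM => //.
rewrite [X in measurable_fun _ X](_ : _ = fun x => p2 x `^ (-1))%R; last first.
  by apply/funext => x; rewrite powR_inv1.
exact: (measurableT_comp (measurable_powR _) mp2).
Qed.

(** The zero set of [p2] is [P2]-null, hence [P1]-null under domination; conversely [p2] vanishes
    almost everywhere on a [P2]-null set. *)
Lemma dominates_densityP :
  P1 `<< P2 <-> {ae mu, forall x, p2 x = 0%R -> p1 x = 0%R}.
Proof.
split=> [/null_content_dominatesP P12|p120].
  pose Z := p2 @^-1` [set 0%R].
  have mZ : measurable Z.
    by rewrite -[X in measurable X]setTI; exact: mp2.
  have : ae_eq mu Z (EFin \o p1) (cst 0).
    apply/ae_eq_integral_abs => //; first exact: measurable_funTS.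
    under eq_integral do rewrite /= ger0_norm//.
    case: P1p => _ _ <-//; apply: P12 => //; change (P2 Z = 0); have [_ _ ->//] := P2p.
    by apply: integral0_eq => x /= ->.
  by apply: filterS => x /= H p2x; case: (H p2x).
apply/null_content_dominatesP => A mA; have [_ _ P1E] := P1p; have [_ _ P2E] := P2p.
change (P2 A = 0 -> P1 A = 0); rewrite P2E// P1E// => p2A.
have : ae_eq mu A (EFin \o p2) (cst 0).
  apply/ae_eq_integral_abs => //; first exact: measurable_funTS.
  by under eq_integral do rewrite /= ger0_norm//.
move=> p2A0; rewrite (ae_eq_integral (cst 0)) ?integral0//.
  exact: measurable_funTS.
by apply: filterS2 p120 p2A0 => x /= H + Ax => /(_ Ax) [] /H ->.
Qed.

(** A finite integral forces [f] to be finite almost everywhere. Used in contrapositive form: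
    without domination the integrals of the divergences are +oo. *)
Lemma dominates_of_integral (f : T -> \bar R) :
  measurable_fun [set: T] f -> (forall x, 0 <= f x) ->
  (forall x, p2 x = 0%R -> (0 < p1 x)%R -> f x = +oo) ->
  \int[mu]_x f x < +oo -> P1 `<< P2.
Proof.
move=> mf f0 f12 foo; apply/dominates_densityP.
have : mu.-integrable setT f.
  apply/integrableP; split => //.
  by under eq_integral do rewrite gee0_abs//.
move=> /(integrable_ae measurableT); apply: filterS => x /(_ Logic.I) fx p2x.
apply/eqP; rewrite eq_le p1_ge0 andbT leNgt; apply/negP => p1x.
by move: fx; rewrite f12.
Qed.

(** The integral of [f] may be +oo. With [g = f - 1], the negative part of [g] is at most 1, so its
    integral is finite and can be cancelled from the integrated identity [g^\+ + 1 = f + g^\-]. *)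
Lemma integral_sub1 (f : T -> \bar R) : measurable_fun [set: T] f ->
  (forall x, 0 <= f x) -> \int[P2]_x (f x - 1) = \int[P2]_x f x - 1.
Proof.
move=> mf f0; rewrite integralE.
have mg : measurable_fun [set: T] (fun x => f x - 1) by exact: emeasurable_funB.
have mgp := measurable_funepos mg; have mgn := measurable_funeneg mg.
have int1 : \int[P2]_x (cst 1 x) = 1.
  by rewrite integral_cst// mul1e; exact: probability_setT.
have gn1 x : (fun x => f x - 1)^\- x <= 1.
  rewrite funenegE ge_max lee01 andbT oppeB ?fin_num_adde_defl//.
  by rewrite addeC geeDl// oppe_le0.
have Nfin : \int[P2]_x (fun x => f x - 1)^\- x \is a fin_num.
  rewrite ge0_fin_numE ?integral_ge0//; apply: (@le_lt_trans _ _ 1); last exact: ltry.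
  by rewrite -[leRHS]int1; apply: ge0_le_integral.
have : \int[P2]_x (fun x => f x - 1)^\+ x + 1 =
    \int[P2]_x f x + \int[P2]_x (fun x => f x - 1)^\- x.
  rewrite -[X in _ + X = _]int1 -!ge0_integralD//; apply: eq_integral => x _.
  have := f0 x; rewrite funeposE funenegE; case: (f x) => [y|_|//]; last first.
    by rewrite /= maxye maxNye adde0.
  rewrite lee_fin => y0; rewrite -EFinB -EFinN -!EFin_max -!EFinD; congr EFin.
  by rewrite !maxEle; case: ifP; case: ifP; lra.
case: (\int[P2]_x (fun x => f x - 1)^\- x) Nfin => // n _.
by case: (\int[P2]_x (fun x => f x - 1)^\+ x) => [u||];
  case: (\int[P2]_x f x) => [v||] //= [] uv; congr EFin; lra.
Qed.

Hypotheses (p1E : density mu P1 = p1) (p2E : density mu P2 = p2).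

(** Only the set where [p2 = 0] is at stake. There [power_integrand] is 0 if [r < 0]; if [r > 0] it
    is +oo where [p1 > 0], which matches the branch without domination. *)
Lemma power_divergenceE r : r != 0%R -> r != (-1)%R ->
  power_divergence mu r P1 P2 =
  ((r * (r + 1))^-1)%:E * (power_integral r p1 p2 - 1).
Proof.
move=> r0 r1; rewrite /power_divergence p1E p2E (negbTE r0) (negbTE r1).
case: ifPn => [/andP[r_gt0 /asboolPn nP12]|nP12].
  have c0 : (0 < (r * (r + 1))^-1)%R by rewrite invr_gt0 mulr_gt0// addr_gt0.
  suff -> : power_integral r p1 p2 = +oo by rewrite addye// gt0_muley// lte_fin.
  apply/eqP; rewrite eq_le leey leNgt; apply/negP => /dominates_of_integral P12.
  apply/nP12/P12 => // x; first exact: power_integrand_ge0.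
  move=> p2x p1x; rewrite p2x /power_integrand pow_oo0_lt0 ?oppr_lt0//.
  by rewrite pow_ooE// gt0_muley// lte_fin powR_gt0.
congr (_ * _).
have mpr : measurable_fun [set: T] (fun x => pow_oo (p1 x / p2 x) (r + 1)).
  exact: (measurableT_comp (measurable_pow_oo _) mratio).
rewrite (integral_sub1 mpr) => [|x]; last exact: pow_oo_ge0.
congr (_ - _); rewrite (integral_is_density P2p)//; last first.
  by move=> x; exact: pow_oo_ge0.
(* Outside the infinite branch, [r > 0] entails domination; for [r <= 0] the implication is
   vacuous. *)
have p120 : {ae mu, forall x, p2 x = 0%R -> (0 < r)%R -> p1 x = 0%R}.
  have [r_gt0|r_le0] := ltP 0%R r; last by apply: aeW => x _; lra.
  move: nP12; rewrite r_gt0/= negbK => /asboolP/dominates_densityP.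
  by apply: filterS => x p120 /p120.
apply: ge0_ae_eq_integral => //.
- exact: emeasurable_funM.
- by move=> x _; rewrite mule_ge0 ?pow_oo_ge0// lee_fin.
- by move=> x _; exact: power_integrand_ge0.
apply: filterS p120 => x p120 _.
have := p2_ge0 x; rewrite le_eqVlt => /predU1P[p2x|p2x]; last first.
  exact: power_integrand_div.
rewrite -p2x mule0 /power_integrand.
have [r_lt0|r_gt0|rE] := ltgtP r 0%R; last by rewrite rE eqxx in r0.
  by rewrite (@pow_oo0 _ (- r)) ?oppr_gt0// mule0.
by rewrite p120// (@pow_oo0 _ (r + 1)) ?mul0e// addr_gt0.
Qed.

(** Both densities have mass 1, so the correction [p2 - p1] integrates to 0. The logarithm is split
    into its positive and negative parts, the latter having a finite integral. *)
Lemma KLE : KL mu P1 P2 = KL_integral p1 p2.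
Proof.
rewrite /KL p1E p2E; case: ifPn => [/asboolP P12|/asboolPn nP12]; last first.
  apply/esym/eqP; rewrite eq_le leey leNgt; apply/negP => /dominates_of_integral P12.
  apply/nP12/P12 => // x; first exact: KL_integrand_ge0.
  by move=> -> p1x; rewrite KL_integrand0r.
pose g x := (ln (p1 x / p2 x))%:E; rewrite integralE -/g.
have mg : measurable_fun [set: T] g.
  by apply/measurable_EFinP/measurableT_comp => //; exact: measurable_ln.
have mgp := measurable_funepos mg; have mgn := measurable_funeneg mg.
rewrite !(integral_is_density P1p)//.
(* By [mulr_ln_ge], [p1 * ln (p1 / p2)] is at least [- p2]. Where [p2 = 0], the conventions on
   inverse and logarithm at 0 make the left side 0. *)
have gn x : g^\- x * (p1 x)%:E <= (p2 x)%:E.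
  rewrite funenegE /g -EFinN -EFin_max -EFinM lee_fin.
  have := p1_ge0 x; rewrite le_eqVlt => /predU1P[<-|p1x]; first by rewrite mulr0.
  have := p2_ge0 x; rewrite le_eqVlt => /predU1P[<-|p2x].
    by rewrite invr0 mulr0 ln0// oppr0 maxxx mul0r.
  rewrite maxEle; case: ifPn => _; first by rewrite mul0r.
  have := mulr_ln_ge p1x p2x; nra.
have mgnp : measurable_fun [set: T] (fun x => g^\- x * (p1 x)%:E).
  exact: emeasurable_funM.
have mgpp : measurable_fun [set: T] (fun x => g^\+ x * (p1 x)%:E).
  exact: emeasurable_funM.
have gp0 x : 0 <= g^\+ x * (p1 x)%:E by rewrite mule_ge0// lee_fin.
have gn0 x : 0 <= g^\- x * (p1 x)%:E by rewrite mule_ge0// lee_fin.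
have Nfin : \int[mu]_x (g^\- x * (p1 x)%:E) \is a fin_num.
  rewrite ge0_fin_numE ?integral_ge0//; apply: (@le_lt_trans _ _ 1); last exact: ltry.
  by rewrite -(integral_density P2p); apply: ge0_le_integral.
(* The first 1 is the integral of [p2] and the second that of [p1]. Pointwise the identity is the
   definition of [KL_integrand]; domination settles the points with [p2 = 0]. *)
have : \int[mu]_x (g^\+ x * (p1 x)%:E) + 1 =
    KL_integral p1 p2 + 1 + \int[mu]_x (g^\- x * (p1 x)%:E).
  rewrite -{1}(integral_density P2p) -(integral_density P1p) /KL_integral.
  have KL0 x := KL_integrand_ge0 (p1_ge0 x) (p2_ge0 x).
  have p10 x : 0 <= (p1 x)%:E by rewrite lee_fin.
  have p20 x : 0 <= (p2 x)%:E by rewrite lee_fin.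
  have KLp10 x : 0 <= KL_integrand (p1 x) (p2 x) + (p1 x)%:E by rewrite adde_ge0.
  have mKLp1 : measurable_fun setT (fun x => KL_integrand (p1 x) (p2 x) + (p1 x)%:E).
    exact: emeasurable_funD.
  rewrite -!ge0_integralD//.
  apply: ge0_ae_eq_integral => //.
  - exact: emeasurable_funD.
  - exact: emeasurable_funD.
  - by move=> x _; rewrite adde_ge0.
  - by move=> x _; rewrite adde_ge0.
  have := dominates_densityP.1 P12; apply: filterS => x p120 _.
  have := p2_ge0 x; rewrite le_eqVlt => /predU1P[p2x|p2x].
    by rewrite (p120 (esym p2x)) -p2x !mule0 KL_integrand0l !adde0.
  rewrite KL_integrandE// funeposE funenegE /g -!EFinN -!EFin_max -!EFinM.
  rewrite -!EFinD; congr EFin; rewrite !maxEle oppr_le0.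
  by case: ltgtP => [_|_|->]; ring.
case: (\int[mu]_x (g^\- x * _)) Nfin => // n _.
by case: (\int[mu]_x (g^\+ x * _)) => [u||];
  case: (KL_integral p1 p2) => [v||] //= [] uv; congr EFin; lra.
Qed.

End power_divergence_integral.

(** * Divergence of joint laws *)

Section divergence_bound.
Context (R : realType).
Local Open Scope ereal_scope.

(** Restates the bound through [1 + c * e], the quantity that is multiplicative under composition;
    infinite [H] is included. *)
Lemma divergence_bound_gt0 (c e : R) (H : \bar R) : (0 < c)%R ->
  ((c^-1)%:E * (H - 1) <= e%:E) = (H <= (1 + c * e)%:E).
Proof.
move=> c0; case: H => [h||]; last 2 first.
- by rewrite addye// gt0_muley ?lte_fin ?invr_gt0//.
- by rewrite addNye gt0_muleNy ?lte_fin ?invr_gt0// !leNye.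
by rewrite -EFinB -EFinM !lee_fin ler_pdivrMl// lerBlDl.
Qed.

(** Dividing by a negative [c] reverses the inequality: a small divergence means a large [H]. *)
Lemma divergence_bound_lt0 (c e : R) (H : \bar R) : (c < 0)%R ->
  ((c^-1)%:E * (H - 1) <= e%:E) = ((1 + c * e)%:E <= H).
Proof.
move=> c0; case: H => [h||]; last 2 first.
- by rewrite addye// lt0_muley ?lte_fin ?invr_lt0// leNye leey.
- by rewrite addNye lt0_muleNy ?lte_fin ?invr_lt0//.
by rewrite -EFinB -EFinM !lee_fin ler_ndivrMl// lerBrDl.
Qed.

End divergence_bound.

(** * Chain rules for the power and Kullback-Leibler integrals *)

Section joint_divergence.
Context (R : realType) d1 d2 (T1 : measurableType d1) (T2 : measurableType d2).
Variables (mu1 : {sigma_finite_measure set T1 -> \bar R})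
          (mu2 : {sigma_finite_measure set T2 -> \bar R}).
Hypothesis detT2 : countably_determined R T2.
Variables (P P' : probability T1 R) (K K' : T1 -> pprobability T2 R).
Variables Q Q' : probability (T1 * T2)%type R.
Hypotheses (mK : measurable_fun [set: T1] K) (mK' : measurable_fun [set: T1] K').
Local Open Scope ereal_scope.
Hypothesis QE : forall A, measurable A -> Q A = \int[P]_v K v (xsection A v).
Hypothesis QE' :
  forall A, measurable A -> Q' A = \int[P']_v K' v (xsection A v).

Section integral.
Variables (p p' : T1 -> R) (k k' : T1 -> T2 -> R) (q q' : T1 * T2 -> R).
Hypotheses (Pp : is_density mu1 P p) (Pp' : is_density mu1 P' p').
Hypotheses (Kk : forall v, is_density mu2 (K v) (k v))
           (Kk' : forall v, is_density mu2 (K' v) (k' v)).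
Hypotheses (Qq : is_density (sigma_finite_prod mu1 mu2) Q q)
           (Qq' : is_density (sigma_finite_prod mu1 mu2) Q' q').

Let p0 v : (0 <= p v)%R. Proof. exact: density_ge0 Pp v. Qed.
Let p'0 v : (0 <= p' v)%R. Proof. exact: density_ge0 Pp' v. Qed.
Let k0 v y : (0 <= k v y)%R. Proof. exact: density_ge0 (Kk v) y. Qed.
Let k'0 v y : (0 <= k' v y)%R. Proof. exact: density_ge0 (Kk' v) y. Qed.
Let q0 z : (0 <= q z)%R. Proof. exact: density_ge0 Qq z. Qed.
Let q'0 z : (0 <= q' z)%R. Proof. exact: density_ge0 Qq' z. Qed.
Let mp := measurable_density Pp.
Let mp' := measurable_density Pp'.
Let mk v := measurable_density (Kk v).
Let mk' v := measurable_density (Kk' v).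
Let mq := measurable_density Qq.
Let mq' := measurable_density Qq'.

Lemma ae_joint_densities : {ae mu1, forall v,
  {ae mu2, forall y, q (v, y) = p v * k v y /\ q' (v, y) = p' v * k' v y}}%R.
Proof.
have := ae_joint_density detT2 mK QE Pp Kk Qq.
have := ae_joint_density detT2 mK' QE' Pp' Kk' Qq'.
by apply: filterS2 => v; apply: filterS2 => y /(_ Logic.I) [->] /(_ Logic.I) [->].
Qed.

Lemma ae_power_integral_section r : {ae mu1, forall v,
  \int[mu2]_y power_integrand r (q (v, y)) (q' (v, y)) =
  power_integrand r (p v) (p' v) * power_integral mu2 r (k v) (k' v)}.
Proof.
apply: filterS ae_joint_densities => v qv.
have mkk' : measurable_fun setT (fun y => power_integrand r (k v y) (k' v y)).
  exact: measurable_power_integrand.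
rewrite -ge0_integralZl// ?power_integrand_ge0//; last first.
  by move=> y _; exact: power_integrand_ge0.
apply: ge0_ae_eq_integral => //.
- apply: measurable_power_integrand.
    exact: (measurableT_comp mq (pair1_measurable v)).
  exact: (measurableT_comp mq' (pair1_measurable v)).
- exact: measurable_funeM.
- by move=> y _; exact: power_integrand_ge0.
- by move=> y _; rewrite mule_ge0// power_integrand_ge0.
by apply: filterS qv => y [-> ->] _; rewrite power_integrandM.
Qed.

Let mpow r : measurable_fun [set: T1 * T2]
  (fun z => power_integrand r (q z) (q' z)).
Proof. exact: measurable_power_integrand. Qed.

Let pow0 r z : 0 <= power_integrand r (q z) (q' z).
Proof. exact: power_integrand_ge0. Qed.

Let power_integral_fubini r :
  power_integral (sigma_finite_prod mu1 mu2) r q q' =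
  \int[mu1]_v \int[mu2]_y power_integrand r (q (v, y)) (q' (v, y)).
Proof. exact: (fubini_tonelli1 _ (mpow r) (pow0 r)). Qed.

Let mpow_section r : measurable_fun [set: T1]
  (fun v => \int[mu2]_y power_integrand r (q (v, y)) (q' (v, y))).
Proof. exact: (measurable_fun_fubini_tonelli_F _ (mpow r) (pow0 r)). Qed.

Let mpow_p r B : measurable_fun [set: T1]
  (fun v => B * power_integrand r (p v) (p' v)).
Proof. by apply: measurable_funeM; exact: measurable_power_integrand. Qed.

(** Tonelli, with the bound applied to the inner integral at almost every [v]. This direction serves
    [r * (r + 1) > 0], the next one [r * (r + 1) < 0]. *)
Lemma power_integral_joint_le r (B : R) : (0 <= B)%R ->
  (forall v, power_integral mu2 r (k v) (k' v) <= B%:E) ->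
  power_integral (sigma_finite_prod mu1 mu2) r q q' <=
  B%:E * power_integral mu1 r p p'.
Proof.
move=> B0 kB; rewrite power_integral_fubini -ge0_integralZl//; last 2 first.
- exact: measurable_power_integrand.
- by move=> v _; exact: power_integrand_ge0.
apply: ae_ge0_le_integral => //.
- by move=> v _; apply: integral_ge0 => y _; exact: pow0.
- by move=> v _; rewrite mule_ge0 ?lee_fin// power_integrand_ge0.
apply: filterS (ae_power_integral_section r) => v -> _; rewrite muleC.
by rewrite lee_wpmul2r// power_integrand_ge0.
Qed.

Lemma power_integral_joint_ge r (B : R) : (0 <= B)%R ->
  (forall v, B%:E <= power_integral mu2 r (k v) (k' v)) ->
  B%:E * power_integral mu1 r p p' <=
  power_integral (sigma_finite_prod mu1 mu2) r q q'.
Proof.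
move=> B0 kB; rewrite power_integral_fubini -ge0_integralZl//; last 2 first.
- exact: measurable_power_integrand.
- by move=> v _; exact: power_integrand_ge0.
apply: ae_ge0_le_integral => //.
- by move=> v _; rewrite mule_ge0 ?lee_fin// power_integrand_ge0.
- by move=> v _; apply: integral_ge0 => y _; exact: pow0.
apply: filterS (ae_power_integral_section r) => v -> _; rewrite muleC.
by rewrite lee_wpmul2l// power_integrand_ge0.
Qed.

(** Evaluates the correction terms of [KL_integrandM] on a section. *)
Let integral_mix v (a b : R) : (0 <= a)%R -> (0 <= b)%R ->
  \int[mu2]_y (a * k v y + b * k' v y)%:E = (a + b)%:E.
Proof.
move=> a0 b0; under eq_integral do rewrite EFinD !EFinM.
rewrite ge0_integralD//; last 4 first.
- by move=> y _; rewrite mule_ge0 ?lee_fin.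
- by apply: measurable_funeM; exact: measurable_EFin_density (Kk v).
- by move=> y _; rewrite mule_ge0 ?lee_fin.
- by apply: measurable_funeM; exact: measurable_EFin_density (Kk' v).
rewrite !ge0_integralZl// ?lee_fin//; last 4 first.
- exact: measurable_EFin_density (Kk' v).
- by move=> y _; rewrite lee_fin.
- exact: measurable_EFin_density (Kk v).
- by move=> y _; rewrite lee_fin.
by rewrite (integral_density (Kk v)) (integral_density (Kk' v)) !mule1.
Qed.

(** Integrating [KL_integrandM] over the section, both correction terms have the finite integral
    [p v + p' v] and cancel. *)
Lemma ae_KL_integral_section : {ae mu1, forall v,
  \int[mu2]_y KL_integrand (q (v, y)) (q' (v, y)) =
  KL_integrand (p v) (p' v) + (p v)%:E * KL_integral mu2 (k v) (k' v)}.
Proof.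
apply: filterS ae_joint_densities => v qv.
have mkk' : measurable_fun setT (fun y => KL_integrand (k v y) (k' v y)).
  exact: measurable_KL_integrand.
have mpk : measurable_fun setT (fun y => p v * k v y)%R.
  exact: measurable_funM.
have mpk' : measurable_fun setT (fun y => p' v * k' v y)%R.
  exact: measurable_funM.
have mKL : measurable_fun setT
    (fun y => KL_integrand (p v * k v y) (p' v * k' v y)).
  by apply: measurable_KL_integrand => // y; rewrite mulr_ge0.
have KL0 y : 0 <= KL_integrand (p v * k v y) (p' v * k' v y).
  by rewrite KL_integrand_ge0 ?mulr_ge0.
rewrite (_ : \int[mu2]_y _ =
    \int[mu2]_y KL_integrand (p v * k v y) (p' v * k' v y)); last first.
  apply: ge0_ae_eq_integral => //.
  - apply: measurable_KL_integrand => //.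
      exact: (measurableT_comp mq (pair1_measurable v)).
    exact: (measurableT_comp mq' (pair1_measurable v)).
  - by move=> y _; exact: KL_integrand_ge0.
  by apply: filterS qv => y [-> ->].
have mmix a b : measurable_fun setT (fun y => (a * k v y + b * k' v y)%:E).
  by apply/measurable_EFinP; apply: measurable_funD; exact: measurable_funM.
have mix0 a b y : (0 <= a)%R -> (0 <= b)%R -> 0 <= (a * k v y + b * k' v y)%:E.
  by move=> a0 b0; rewrite lee_fin addr_ge0// mulr_ge0.
have mk1 : measurable_fun setT (fun y => KL_integrand (p v) (p' v) * (k v y)%:E).
  by apply: measurable_funeM; exact: measurable_EFin_density (Kk v).
have mk2 : measurable_fun setT (fun y => (p v)%:E * KL_integrand (k v y) (k' v y)).
  exact: measurable_funeM.
have k10 y : 0 <= KL_integrand (p v) (p' v) * (k v y)%:E.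
  by rewrite mule_ge0 ?lee_fin ?KL_integrand_ge0.
have k20 y : 0 <= (p v)%:E * KL_integrand (k v y) (k' v y).
  by rewrite mule_ge0 ?lee_fin ?KL_integrand_ge0.
have : \int[mu2]_y KL_integrand (p v * k v y) (p' v * k' v y) +
    \int[mu2]_y (p' v * k v y + p v * k' v y)%:E =
    \int[mu2]_y (KL_integrand (p v) (p' v) * (k v y)%:E) +
    \int[mu2]_y ((p v)%:E * KL_integrand (k v y) (k' v y)) +
    \int[mu2]_y (p v * k v y + p' v * k' v y)%:E.
  have mix10 y := mix0 (p' v) (p v) y (p'0 v) (p0 v).
  have mix20 y := mix0 (p v) (p' v) y (p0 v) (p'0 v).
  have k120 y : 0 <= KL_integrand (p v) (p' v) * (k v y)%:E +
      (p v)%:E * KL_integrand (k v y) (k' v y) by rewrite adde_ge0.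
  have mk12 : measurable_fun setT (fun y => KL_integrand (p v) (p' v) *
      (k v y)%:E + (p v)%:E * KL_integrand (k v y) (k' v y)).
    exact: emeasurable_funD.
  rewrite -!ge0_integralD//; apply: eq_integral => y _.
  exact: KL_integrandM.
rewrite !integral_mix// ge0_integralZl//; last 3 first.
- exact: measurable_EFin_density (Kk v).
- by move=> y _; rewrite lee_fin.
- exact: KL_integrand_ge0.
rewrite (integral_density (Kk v)) mule1 ge0_integralZl//; last 2 first.
- by move=> y _; exact: KL_integrand_ge0.
- by rewrite lee_fin.
rewrite (addrC (p' v)); set c := (p v + p' v)%R.
by move=> /(congr1 (fun x => x - c%:E)); rewrite !addeK.
Qed.

(** The conditional divergences are averaged against [p], which has mass 1, so they contribute at
    most [B]. *)
Lemma KL_integral_joint_le (B : R) :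
  (forall v, KL_integral mu2 (k v) (k' v) <= B%:E) ->
  KL_integral (sigma_finite_prod mu1 mu2) q q' <=
  KL_integral mu1 p p' + B%:E.
Proof.
move=> kB.
(* Measurable types are inhabited, so the bound can be read at [point]. *)
have B0 : (0 <= B)%R.
  have := kB point; rewrite -lee_fin; apply: le_trans.
  by apply: integral_ge0 => y _; exact: KL_integrand_ge0.
have mKL : measurable_fun setT (fun z => KL_integrand (q z) (q' z)).
  exact: measurable_KL_integrand.
have KL0 z : 0 <= KL_integrand (q z) (q' z) by exact: KL_integrand_ge0.
have -> : KL_integral (sigma_finite_prod mu1 mu2) q q' =
    \int[mu1]_v \int[mu2]_y KL_integrand (q (v, y)) (q' (v, y)).
  exact: (fubini_tonelli1 _ mKL KL0).
(* The constant [B] becomes the integral of [B * p v], to be compared under the integral sign. *)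
rewrite -[X in _ + X]mule1 -(integral_density Pp) -ge0_integralZl//; last 2 first.
- exact: measurable_EFin_density Pp.
- by move=> v _; rewrite lee_fin.
have mKLp : measurable_fun setT (fun v => KL_integrand (p v) (p' v)).
  exact: measurable_KL_integrand.
have mBp : measurable_fun setT (fun v => B%:E * (p v)%:E).
  by apply: measurable_funeM; exact: measurable_EFin_density Pp.
have KLp0 v : 0 <= KL_integrand (p v) (p' v) by exact: KL_integrand_ge0.
have Bp0 v : 0 <= B%:E * (p v)%:E by rewrite mule_ge0// lee_fin.
rewrite -ge0_integralD//.
apply: ae_ge0_le_integral => //.
- by move=> v _; apply: integral_ge0 => y _; exact: KL0.
- exact: (measurable_fun_fubini_tonelli_F _ mKL KL0).
- by move=> v _; rewrite adde_ge0.
- exact: emeasurable_funD.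
apply: filterS ae_KL_integral_section => v -> _.
by rewrite leeD2l// muleC lee_wpmul2r// lee_fin.
Qed.

End integral.

Hypotheses (dP : has_density mu1 P) (dP' : has_density mu1 P').
Hypotheses (dK : forall v, has_density mu2 (K v))
           (dK' : forall v, has_density mu2 (K' v)).

Let dQ : has_density (sigma_finite_prod mu1 mu2) Q.
Proof. exact: has_density_joint mK QE dP dK. Qed.

Let dQ' : has_density (sigma_finite_prod mu1 mu2) Q'.
Proof. exact: has_density_joint mK' QE' dP' dK'. Qed.

Lemma KL_joint_le (e1 e2 : R) : KL mu1 P P' <= e1%:E ->
  (forall v, KL mu2 (K v) (K' v) <= e2%:E) ->
  KL (sigma_finite_prod mu1 mu2) Q Q' <= (e1 + e2)%:E.
Proof.
rewrite (KLE (densityP dP) (densityP dP'))// => P_e1 K_e2.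
rewrite (KLE (densityP dQ) (densityP dQ'))//.
have kB v : KL_integral mu2 (density mu2 (K v)) (density mu2 (K' v)) <= e2%:E.
  by rewrite -(KLE (densityP (dK v)) (densityP (dK' v))).
apply: (le_trans (KL_integral_joint_le (densityP dP) (densityP dP')
  (fun v => densityP (dK v)) (fun v => densityP (dK' v))
  (densityP dQ) (densityP dQ') kB)).
by rewrite EFinD leeD2r.
Qed.

Lemma power_divergence_joint_le r (e1 e2 : R) : r != 0%R -> r != (-1)%R ->
  (0 <= 1 + r * (r + 1) * e1)%R -> (0 <= 1 + r * (r + 1) * e2)%R ->
  power_divergence mu1 r P P' <= e1%:E ->
  (forall v, power_divergence mu2 r (K v) (K' v) <= e2%:E) ->
  power_divergence (sigma_finite_prod mu1 mu2) r Q Q' <=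
  (e1 + e2 + r * (r + 1) * e1 * e2)%:E.
Proof.
move=> r0 r1; set c := (r * (r + 1))%R => ce1 ce2.
rewrite (power_divergenceE (densityP dP) (densityP dP'))// => P_e1 K_e2'.
rewrite (power_divergenceE (densityP dQ) (densityP dQ'))//.
have K_e2 v : (c^-1)%:E *
    (power_integral mu2 r (density mu2 (K v)) (density mu2 (K' v)) - 1) <= e2%:E.
  by rewrite -(power_divergenceE (densityP (dK v)) (densityP (dK' v))).
move: P_e1 K_e2 => {K_e2'}; rewrite -/c.
(* The composed privacy level is exactly the one for which [1 + c * e] multiplies; the sign of [c]
   then selects the direction of the bounds. *)
have cE : (1 + c * (e1 + e2 + c * e1 * e2) = (1 + c * e2) * (1 + c * e1))%R by ring.
have c0 : c != 0%R by rewrite mulf_neq0// addr_eq0.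
have [c_lt0|c_gt0|/eqP] := ltgtP c 0%R; last by rewrite (negbTE c0).
- move=> P_e1 K_e2; rewrite divergence_bound_lt0// cE EFinM.
  apply: le_trans (power_integral_joint_ge (densityP dP) (densityP dP')
    (fun v => densityP (dK v)) (fun v => densityP (dK' v))
    (densityP dQ) (densityP dQ') ce2 _).
    by rewrite lee_wpmul2l ?lee_fin// -divergence_bound_lt0.
  by move=> v; rewrite -divergence_bound_lt0.
- move=> P_e1 K_e2; rewrite divergence_bound_gt0// cE EFinM.
  apply: (le_trans (power_integral_joint_le (densityP dP) (densityP dP')
    (fun v => densityP (dK v)) (fun v => densityP (dK' v))
    (densityP dQ) (densityP dQ') ce2 _)).
    by move=> v; rewrite -divergence_bound_gt0.
  by rewrite lee_wpmul2l ?lee_fin// -divergence_bound_gt0.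
Qed.

End joint_divergence.

Section power_divergence_joint.
Context (R : realType) d1 d2 (T1 : measurableType d1) (T2 : measurableType d2).
Variables (mu1 : {sigma_finite_measure set T1 -> \bar R})
          (mu2 : {sigma_finite_measure set T2 -> \bar R}).
Hypothesis detT2 : countably_determined R T2.
Variables (P P' : probability T1 R) (K K' : T1 -> pprobability T2 R).
Variables Q Q' : probability (T1 * T2)%type R.
Hypotheses (mK : measurable_fun [set: T1] K) (mK' : measurable_fun [set: T1] K').
Local Open Scope ereal_scope.
Hypothesis QE : forall A, measurable A -> Q A = \int[P]_v K v (xsection A v).
Hypothesis QE' :
  forall A, measurable A -> Q' A = \int[P']_v K' v (xsection A v).
Hypotheses (dP : has_density mu1 P) (dP' : has_density mu1 P').
Hypotheses (dK : forall v, has_density mu2 (K v))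
           (dK' : forall v, has_density mu2 (K' v)).

(** For [lambda] equal to 0 or -1 the coefficient [lambda * (lambda + 1)] vanishes and the bound is
    [e1 + e2]. At -1 the arguments of [KL] are exchanged, hence the exchange of primed and unprimed
    data. *)
Lemma divergence_joint_le lambda (e1 e2 : R) :
  (0 <= 1 + lambda * (lambda + 1) * e1)%R ->
  (0 <= 1 + lambda * (lambda + 1) * e2)%R ->
  power_divergence mu1 lambda P P' <= e1%:E ->
  (forall v, power_divergence mu2 lambda (K v) (K' v) <= e2%:E) ->
  power_divergence (mu1 \x mu2) lambda Q Q' <=
  (e1 + e2 + lambda * (lambda + 1) * e1 * e2)%:E.
Proof.
move=> ce1 ce2; have [->|l0] := eqVneq lambda 0%R.
  rewrite /power_divergence eqxx !mul0r addr0.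
  exact: (KL_joint_le detT2 mK mK' QE QE' dP dP' dK dK').
have [->|l1] := eqVneq lambda (-1)%R; last first.
  exact: (power_divergence_joint_le detT2 mK mK' QE QE' dP dP' dK dK').
rewrite /power_divergence oppr_eq0 oner_eq0 eqxx addNr mulr0 !mul0r addr0.
exact: (KL_joint_le detT2 mK' mK QE' QE dP' dP dK' dK).
Qed.

End power_divergence_joint.

(** Serves parallel composition, where the component whose data do not change contributes divergence
    0. *)
Lemma power_divergence_diag (R : realType) d (T : measurableType d)
    (mu : {sigma_finite_measure set T -> \bar R}) lambda (P : probability T R) :
  has_density mu P -> (power_divergence mu lambda P P = 0)%E.
Proof.
move=> dP; have Pp := densityP dP; have p0 := density_ge0 Pp.
have KL0 : (KL mu P P = 0)%E.
  rewrite (KLE Pp Pp)//; apply: integral0_eq => x _; exact: KL_integrand_diag.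
have [->|l0] := eqVneq lambda 0; first by rewrite /power_divergence eqxx.
have [->|l1] := eqVneq lambda (-1).
  by rewrite /power_divergence oppr_eq0 oner_eq0 eqxx.
rewrite (power_divergenceE Pp Pp)// /power_integral.
under eq_integral do rewrite power_integrand_diag//.
by rewrite (integral_density Pp) subee// mule0.
Qed.

(** * Composition of mechanisms *)

Section admissible.
Context (R : realType).
Implicit Types lambda e : R.

(** For negative [c = lambda * (lambda + 1)], the condition [e < - c^-1] reads [0 < 1 + c * e]. The
    sign is what allows bounds to be multiplied. *)
Lemma admissible_ge0 lambda e : admissible lambda e ->
  0 <= 1 + lambda * (lambda + 1) * e.
Proof.
move=> [e0 ec]; have [c0|c0] := leP 0 (lambda * (lambda + 1)).
  by rewrite addr_ge0// mulr_ge0// ltW.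
have := ec c0; rewrite -invrN -[X in _ < X]mulr1 ltr_pdivlMl ?oppr_gt0//.
by rewrite mulNr; lra.
Qed.

(** For [c < 0] admissibility means [0 < e] and [0 < 1 + c * e], and the latter is preserved because
    these factors multiply. *)
Lemma admissible_composition lambda e1 e2 :
  admissible lambda e1 -> admissible lambda e2 ->
  admissible lambda (e1 + e2 + lambda * (lambda + 1) * e1 * e2).
Proof.
move=> a1 a2; move: (a1) (a2) => [e10 ec1] [e20 ec2].
set c := lambda * (lambda + 1); have [c0|c0] := leP 0 c.
  split; last by rewrite ltNge c0.
  have := mulr_ge0 (mulr_ge0 c0 (ltW e10)) (ltW e20); lra.
have bound e : (e < - c^-1) = (0 < 1 + c * e).
  rewrite -invrN -[X in _ < X]mulr1 ltr_pdivlMl ?oppr_gt0//.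
  by rewrite mulNr ltrNl -ltrBlDl sub0r.
have ce1 : 0 < 1 + c * e1 by rewrite -bound; exact: ec1.
have ce2 : 0 < 1 + c * e2 by rewrite -bound; exact: ec2.
split; last first.
  by move=> _; rewrite bound; have := mulr_gt0 ce1 ce2; lra.
(* The composed level equals [e1 + e2 * (1 + c * e1)]. *)
have := mulr_gt0 e20 ce1; lra.
Qed.

Lemma admissible_max lambda e1 e2 :
  admissible lambda e1 -> admissible lambda e2 ->
  admissible lambda (Num.max e1 e2).
Proof. by move=> a1 a2; rewrite maxEle; case: ifP. Qed.

End admissible.

Section composition.
Context (R : realType).
Local Open Scope ereal_scope.

Lemma hamming_eq0 n (D D' : n.-tuple R) : hamming D D' = 0%N -> D = D'.
Proof.
move=> /card0_eq DD'; apply: eq_from_tnth => i; apply/eqP/negPn/negP => ne.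
have : i \in in_set [set i : 'I_n | tnth D i != tnth D' i] by exact: mem_set.
by rewrite DD'.
Qed.

Variables (m1 m2 : nat).
Local Notation mu1 := (lebesgue_tuple R m1).
Local Notation mu2 := (lebesgue_tuple R m2).

Lemma adaptive_law_divergence_le (P P' : probability (m1.-tuple R) R)
    (K K' : m1.-tuple R -> pprobability (m2.-tuple R) R)
    (mK : measurable_fun [set: m1.-tuple R] K)
    (mK' : measurable_fun [set: m1.-tuple R] K') lambda (e1 e2 : R) :
  has_density mu1 P -> has_density mu1 P' ->
  (forall v, has_density mu2 (K v)) -> (forall v, has_density mu2 (K' v)) ->
  (0 <= 1 + lambda * (lambda + 1) * e1)%R ->
  (0 <= 1 + lambda * (lambda + 1) * e2)%R ->
  power_divergence mu1 lambda P P' <= e1%:E ->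
  (forall v, power_divergence mu2 lambda (K v) (K' v) <= e2%:E) ->
  power_divergence (lebesgue_pair R m1 m2) lambda
    [the probability _ R of adaptive_law P mK]
    [the probability _ R of adaptive_law P' mK'] <=
  (e1 + e2 + lambda * (lambda + 1) * e1 * e2)%:E.
Proof.
move=> dP dP' dK dK' ce1 ce2 Pe1 Ke2.
apply: (@divergence_joint_le R _ _ _ _ mu1 mu2 _ P P' K K' _ _ mK mK') => //.
exact: countably_determined_tuple.
Qed.

Lemma adaptive_law_has_density (P : probability (m1.-tuple R) R)
    (K : m1.-tuple R -> pprobability (m2.-tuple R) R)
    (mK : measurable_fun [set: m1.-tuple R] K) :
  has_density mu1 P -> (forall v, has_density mu2 (K v)) ->
  has_density (lebesgue_pair R m1 m2)
    [the probability _ R of adaptive_law P mK].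
Proof. by apply: (@has_density_joint R _ _ _ _ mu1 mu2 P K). Qed.

(** Independence is the case of the constant kernel [cst K], whose joint law is the product measure
    by definition. *)
Lemma independent_law_divergence_le (P P' : probability (m1.-tuple R) R)
    (K K' : probability (m2.-tuple R) R) lambda (e1 e2 : R) :
  has_density mu1 P -> has_density mu1 P' ->
  has_density mu2 K -> has_density mu2 K' ->
  (0 <= 1 + lambda * (lambda + 1) * e1)%R ->
  (0 <= 1 + lambda * (lambda + 1) * e2)%R ->
  power_divergence mu1 lambda P P' <= e1%:E ->
  power_divergence mu2 lambda K K' <= e2%:E ->
  power_divergence (lebesgue_pair R m1 m2) lambda
    (independent_law P K) (independent_law P' K') <=
  (e1 + e2 + lambda * (lambda + 1) * e1 * e2)%:E.
Proof.
move=> dP dP' dK dK' ce1 ce2 Pe1 Ke2.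
apply: (@divergence_joint_le R _ _ _ _ mu1 mu2 _ P P' (cst K) (cst K')) => //.
exact: countably_determined_tuple.
Qed.

Lemma independent_law_has_density (P : probability (m1.-tuple R) R)
    (K : probability (m2.-tuple R) R) :
  has_density mu1 P -> has_density mu2 K ->
  has_density (lebesgue_pair R m1 m2) (independent_law P K).
Proof.
move=> dP dK.
by apply: (@has_density_joint R _ _ _ _ mu1 mu2 P (cst K)).
Qed.

End composition.

Theorem theorem2p1 (R : realType) (lambda eps1 eps2 : R)
    (heps1 : admissible lambda eps1) (heps2 : admissible lambda eps2) :
  [/\ (* adaptive composition *)
      forall (n k m1 m2 : nat) (DB : set (n.-tuple R))
        (W : n.-tuple R -> k.-tuple R)
        (M1 : mechanism R k n m1) (M2 : mechanism R m1 n m2)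
        (mM2 : forall D, measurable_fun [set: m1.-tuple R]
                 (M2 ^~ D : _ -> pprobability (m2.-tuple R) R)),
        measurable_fun DB W ->
        PDP DB (@hamming R n) (lebesgue_tuple R m1) lambda eps1
          (fun D => M1 (W D) D) ->
        (forall v : m1.-tuple R,
          PDP DB (@hamming R n) (lebesgue_tuple R m2) lambda eps2 (M2 v)) ->
        PDP DB (@hamming R n) (lebesgue_pair R m1 m2) lambda
          (eps1 + eps2 + lambda * (lambda + 1) * eps1 * eps2)
          (fun D => adaptive_composition M1 mM2 (W D) D),
      (* sequential composition *)
      forall (n k m1 m2 : nat) (DB : set (n.-tuple R))
        (W : n.-tuple R -> k.-tuple R)
        (M1 : mechanism R k n m1) (M2 : mechanism R k n m2),
        measurable_fun DB W ->
        PDP DB (@hamming R n) (lebesgue_tuple R m1) lambda eps1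
          (fun D => M1 (W D) D) ->
        PDP DB (@hamming R n) (lebesgue_tuple R m2) lambda eps2
          (fun D => M2 (W D) D) ->
        PDP DB (@hamming R n) (lebesgue_pair R m1 m2) lambda
          (eps1 + eps2 + lambda * (lambda + 1) * eps1 * eps2)
          (fun D => independent_law (M1 (W D) D) (M2 (W D) D))
    & (* parallel composition *)
      forall (n1 n2 k1 k2 m1 m2 : nat)
        (DB1 : set (n1.-tuple R)) (DB2 : set (n2.-tuple R))
        (W1 : n1.-tuple R -> k1.-tuple R) (W2 : n2.-tuple R -> k2.-tuple R)
        (M1 : mechanism R k1 n1 m1) (M2 : mechanism R k2 n2 m2),
        measurable_fun DB1 W1 -> measurable_fun DB2 W2 ->
        PDP DB1 (@hamming R n1) (lebesgue_tuple R m1) lambda eps1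
          (fun D => M1 (W1 D) D) ->
        PDP DB2 (@hamming R n2) (lebesgue_tuple R m2) lambda eps2
          (fun D => M2 (W2 D) D) ->
        PDP (parallel_database DB1 DB2) (@parallel_hamming R n1 n2)
          (lebesgue_pair R m1 m2) lambda (Num.max eps1 eps2)
          (fun D => independent_law (M1 (W1 D.1) D.1) (M2 (W2 D.2) D.2)) ].
Proof.
split.
- move=> n k m1 m2 DB W M1 M2 mM2 _ [_ dM1 M1e] M2P; split.
  + exact: admissible_composition.
  + move=> D DBD; apply: (adaptive_law_has_density (mM2 D)); first exact: dM1.
    by move=> v; have [_ dM2 _] := M2P v; exact: dM2.
  + move=> D D' DBD DBD' DD'.
    (* The second mechanism is compared on [D] and [D'] at the same fixed input [v]. *)
    apply: (adaptive_law_divergence_le (mM2 D) (mM2 D')).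
    * exact: dM1.
    * exact: dM1.
    * by move=> v; have [_ dM2 _] := M2P v; exact: dM2.
    * by move=> v; have [_ dM2 _] := M2P v; exact: dM2.
    * exact: admissible_ge0.
    * exact: admissible_ge0.
    * exact: M1e.
    * by move=> v; have [_ _ M2e] := M2P v; exact: M2e.
- move=> n k m1 m2 DB W M1 M2 _ [_ dM1 M1e] [_ dM2 M2e]; split.
  + exact: admissible_composition.
  + move=> D DBD; apply: independent_law_has_density; [exact: dM1|exact: dM2].
  + move=> D D' DBD DBD' DD'; apply: independent_law_divergence_le.
    * exact: dM1.
    * exact: dM1.
    * exact: dM2.
    * exact: dM2.
    * exact: admissible_ge0.
    * exact: admissible_ge0.
    * exact: M1e.
    * exact: M2e.
- move=> n1 n2 k1 k2 m1 m2 DB1 DB2 W1 W2 M1 M2 _ _ [_ dM1 M1e] [_ dM2 M2e]; split.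
  + exact: admissible_max.
  + move=> D [D1 D2 _].
    apply: independent_law_has_density; [exact: dM1|exact: dM2].
  + move=> [D1 D2] [D1' D2'] [/= DBD1 DBD2 _] [/= DBD1' DBD2' _].
    rewrite /parallel_hamming/= => h12.
    (* The unchanged component enters with level 0, for which the composed level reduces to that of
       the other component. *)
    have c0 : 0 <= 1 + lambda * (lambda + 1) * 0 by rewrite mulr0 addr0.
    have dP1 := dM1 _ DBD1; have dP1' := dM1 _ DBD1'.
    have dP2 := dM2 _ DBD2; have dP2' := dM2 _ DBD2'.
    (* The two distances sum to 1, so exactly one component changes, and that component is an
       adjacent pair. *)
    have [h1|h1] := posnP (hamming D1 D1').
      have E := hamming_eq0 h1; move: h12; rewrite h1 add0n => /(M2e _ _ DBD2 DBD2') e2P.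
      rewrite -E in dP1' *.
      have := independent_law_divergence_le dP1 dP1 dP2 dP2' c0 (admissible_ge0 heps2) _ e2P.
      rewrite power_divergence_diag// => /(_ (lexx _)) /le_trans; apply.
      by rewrite lee_fin mulr0 mul0r add0r addr0 le_max lexx orbT.
    have h2 : hamming D2 D2' = 0%N by lia.
    have E := hamming_eq0 h2; move: h12; rewrite h2 addn0 => /(M1e _ _ DBD1 DBD1') e1P.
    rewrite -E in dP2' *.
    have := independent_law_divergence_le dP1 dP1' dP2 dP2 (admissible_ge0 heps1) c0 e1P.
    rewrite power_divergence_diag// => /(_ (lexx _)) /le_trans; apply.
    by rewrite lee_fin mulr0 !addr0 le_max lexx.
Qed.
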